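(* Consider the complex $2\times 2$ matrices $$0_2=\begin{bmatrix}0&0\\0&0\end{bmatrix},\quad D=\begin{bmatrix}1&0\\0&0\end{bmatrix},\quad I_2=\begin{bmatrix}1&0\\0&1\end{bmatrix},\quad H_2(-1)=\begin{bmatrix}0&1\\-1&0\end{bmatrix},\quad \Gamma_2=\begin{bmatrix}0&-1\\1&1\end{bmatrix},\quad H_2(\lambda)=\begin{bmatrix}0&1\\\lambda&0\end{bmatrix}\ (\lambda\in\mathbb C\setminus\{-1,1\}),$$ where each nonzero $\lambda$ is determined up to replacement by $\lambda^{-1}$. Every complex $2\times 2$ matrix is congruent to exactly one of these matrices (with $H_2(\lambda)$ and $H_2(\lambda^{-1})$ identified for $\lambda\neq 0$), so they represent the vertices of the closure graph $G_2$ for congruence classes of $2\times2$ matrices. The arrows of $G_2$ are exactly $$0_2\to H_2(-1),\quad 0_2\to D,\quad H_2(-1)\to\Gamma_2,\quad D\to \Gamma_2,\quad D\to I_2,\quad D\to H_2(\lambda)\ \text{ for each }\lambda\in\mathbb C\setminus\{-1,1\}.$$ The dimensions of the congruence classes are: $0$ for $0_2$; $1$ for $H_2(-1)$; $2$ for $D$; and $3$ for each of $\Gamma_2$, $I_2$ and $H_2(\lambda)$ ($\lambda\ne\pm1$).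
   Context: All matrices are over $\mathbb C$. Two $n\times n$ matrices $A,B$ are congruent if $S^TAS=B$ for some nonsingular $S$; the equivalence classes are called congruence classes. The closure graph $G_n$ for congruence classes of $n\times n$ matrices is the directed graph whose vertices are in bijection with the congruence classes of $n\times n$ complex matrices and in which there is a directed path (possibly of length $0$) from $v$ to $w$ if and only if one (equivalently, each) matrix in the congruence class $C_v$ can be transformed to a matrix in $C_w$ by an arbitrarily small perturbation, i.e. $C_v\subseteq\overline{C_w}$. It is the Hasse diagram of the partial order $C_v\preccurlyeq C_w :\Leftrightarrow C_v\subseteq\overline{C_w}$, so its arrows are the covering relations of this order. The dimension of the congruence class of $A\in\mathbb C^{n\times n}$ is $\dim_{\mathbb C}\{X^TA+AX\mid X\in\mathbb C^{n\times n}\}$. *)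

(* Defs.v *)
From HB Require Import structures.
From mathcomp Require Import all_boot all_order all_algebra.
From mathcomp Require Import complex.
From mathcomp Require Import all_classical all_reals all_analysis.

Set Implicit Arguments.
Unset Strict Implicit.
Unset Printing Implicit Defensive.

Import Order.TTheory GRing.Theory Num.Theory.
Import numFieldNormedType.Exports.

Local Open Scope classical_set_scope.
Local Open Scope ring_scope.

(* R[i] is wrapped as a numClosedFieldType because the norm topology is attached
   to numeric field structures, not to the carrier R[i] itself; 'M[Cplx R]_n then
   carries the usual (entrywise) topology. *)
Definition Cplx (R : realType) : numClosedFieldType := R[i]%C.

Section congruence.
Variables (R : realType) (n : nat).
Implicit Types A B S X : 'M[Cplx R]_n.

Definition congruent A B : Prop :=
  exists2 S, S \in unitmx & S^T *m A *m S = B.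

Definition congr_class A : set 'M[Cplx R]_n := [set B | congruent A B].

Definition congr_tangent A X : 'M[Cplx R]_n := X^T *m A + A *m X.

Lemma congr_tangent_is_linear A : linear (congr_tangent A).
Proof.
move=> a X Y; rewrite /congr_tangent linearP /= mulmxDl mulmxDr.
by rewrite -scalemxAl -scalemxAr scalerDr addrACA.
Qed.

HB.instance Definition _ A :=
  GRing.isLinear.Build (Cplx R) 'M[Cplx R]_n 'M[Cplx R]_n *:%R
    (congr_tangent A) (congr_tangent_is_linear A).

Definition congr_class_dim A : nat := \dim (limg (linfun (congr_tangent A))).

Definition closure_vertex : Type :=
  {V : set 'M[Cplx R]_n | range congr_class V}.

Definition vertex_of A : closure_vertex :=
  exist _ (congr_class A) (ex_intro2 _ _ A I erefl).

Definition closure_le (V W : closure_vertex) : Prop :=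
  sval V `<=` closure (sval W).

(* The closure graph is the Hasse diagram of closure_le. *)
Definition closure_arrow (V W : closure_vertex) : Prop :=
  [/\ V <> W, closure_le V W &
      forall U, closure_le V U -> closure_le U W -> U = V \/ U = W].

End congruence.

Section canonical_matrices.
Variable R : realType.
Local Notation C := (Cplx R).

Definition mx22 (a b c d : C) : 'M[C]_2 :=
  \matrix_(i, j) if i == 0 then (if j == 0 then a else b)
                 else (if j == 0 then c else d).

Definition D2 : 'M[C]_2 := mx22 1 0 0 0.
Definition H2 (l : C) : 'M[C]_2 := mx22 0 1 l 0.
Definition Gamma2 : 'M[C]_2 := mx22 0 (-1) 1 1.

Definition canonical2 : set 'M[C]_2 :=
  [set F | [\/ F = 0, F = D2, F = 1%:M | F = H2 (-1)]] `|`
  [set Gamma2] `|` [set H2 l | l in [set l | l != -1 /\ l != 1]].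

End canonical_matrices.

Arguments D2 {R}.
Arguments Gamma2 {R}.
Arguments canonical2 {R}.

(* Main.v *)
(* For A = [a b; c d] put k = b - c and p = 4 a d - (b + c)^2, which is four times
   the determinant of the symmetric part. A congruence by S multiplies k by det S
   and p by (det S)^2. If A is not skew-symmetric, choose v with v^T A v = 1 and
   complete it by a vector w orthogonal to v for the symmetric part, det [v w] = 1:
   this brings A to [1 k/2; -k/2 p/4]. Hence (k, p), up to (k, p) ~ (s k, s^2 p),
   together with skew-symmetry is a complete invariant.

   Closed conditions on A expressed by k, p and the entries of the symmetric part
   give the necessary conditions for a degeneration; the lines A + t B give the
   converse. The resulting order is graded by [height], so its arrows are the
   degenerations which raise the height by one. *)

Require Import Defs.
From mathcomp Require Import all_boot all_order all_algebra.
From mathcomp Require Import complex ring.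
From mathcomp Require Import all_classical all_reals all_analysis.

Set Implicit Arguments.
Unset Strict Implicit.
Unset Printing Implicit Defensive.

Import Order.TTheory GRing.Theory Num.Theory.
Import numFieldNormedType.Exports.

Local Open Scope classical_set_scope.
Local Open Scope ring_scope.

(** * Preliminaries on images of linear maps and explicit two-by-two matrices *)

Lemma dim_limg_span (K : fieldType) (U W : vectType K) (f : 'Hom(U, W))
    (e : seq W) : free e -> (forall u, f u \in <<e>>%VS) ->
  (forall v, v \in e -> exists u, f u = v) -> \dim (limg f) = size e.
Proof.
move=> fe fu ef; rewrite -(eqnP fe); congr (\dim _); apply/eqP.
rewrite eqEsubv; apply/andP; split.
  by apply/subvP => _ /memv_imgP[u _ ->].
by apply/span_subvP => v /ef[u <-]; apply: memv_img; apply: memvf.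
Qed.

Section Congruence2.
Variable R : realType.
Local Notation C := (Cplx R).
Implicit Types (A B F S X : 'M[C]_2) (a b c d k l p s t x y z w : C)
  (V W : closure_vertex R 2).

Lemma mx22E a b c d :
  ((mx22 a b c d 0 0 = a) * (mx22 a b c d 0 1 = b)) *
  ((mx22 a b c d 1 0 = c) * (mx22 a b c d 1 1 = d)).
Proof. by rewrite !mxE. Qed.

Lemma mx22_eta A : A = mx22 (A 0 0) (A 0 1) (A 1 0) (A 1 1).
Proof.
apply/matrixP => i j; rewrite !mxE.
case: i => [[|[|]]] // ?; case: j => [[|[|]]] // ? /=;
  by congr (A _ _); apply/val_inj.
Qed.

Lemma mx22_inj a b c d a' b' c' d' : mx22 a b c d = mx22 a' b' c' d' ->
  [/\ a = a', b = b', c = c' & d = d'].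
Proof.
move/matrixP=> e; split.
- by move: (e 0 0); rewrite !mxE.
- by move: (e 0 1); rewrite !mxE.
- by move: (e 1 0); rewrite !mxE.
- by move: (e 1 1); rewrite !mxE.
Qed.

Lemma tr_mx22 a b c d : (mx22 a b c d)^T = mx22 a c b d.
Proof. by rewrite [LHS]mx22_eta !mxE. Qed.

Lemma mul_mx22 a b c d a' b' c' d' : mx22 a b c d *m mx22 a' b' c' d' =
  mx22 (a * a' + b * c') (a * b' + b * d') (c * a' + d * c') (c * b' + d * d').
Proof.
by rewrite [LHS]mx22_eta !mxE !big_ord_recr !big_ord0 /= !mxE /= !add0r.
Qed.

Lemma add_mx22 a b c d a' b' c' d' : mx22 a b c d + mx22 a' b' c' d' =
  mx22 (a + a') (b + b') (c + c') (d + d').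
Proof. by rewrite [LHS]mx22_eta !mxE. Qed.

Lemma scale_mx22 a b c d s : s *: mx22 a b c d = mx22 (s * a) (s * b) (s * c) (s * d).
Proof. by rewrite [LHS]mx22_eta !mxE. Qed.

Lemma opp_mx22 a b c d : - mx22 a b c d = mx22 (- a) (- b) (- c) (- d).
Proof. by rewrite [LHS]mx22_eta !mxE. Qed.

Lemma mx22_0 : 0 = mx22 0 0 0 0 :> 'M[C]_2.
Proof. by rewrite [LHS]mx22_eta !mxE. Qed.

Lemma mx22_1 : 1%:M = mx22 1 0 0 1 :> 'M[C]_2.
Proof. by rewrite [LHS]mx22_eta !mxE. Qed.

Lemma det_mx22 a b c d : \det (mx22 a b c d) = a * d - b * c.
Proof.
rewrite (expand_det_row _ 0) !big_ord_recr big_ord0 /= /cofactor !det_mx11 !mxE /=.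
ring.
Qed.

(** * Invariants of congruence and the normal form *)

Definition skew_coef A : C := A 0 1 - A 1 0.
(* Four times the determinant of the symmetric part. *)
Definition sym_disc A : C := 4 * (A 0 0 * A 1 1) - (A 0 1 + A 1 0) ^+ 2.
Definition skewsymmetric A : bool := A^T == - A.

Lemma skew_coef_congr S A : skew_coef (S^T *m A *m S) = \det S * skew_coef A.
Proof.
rewrite (mx22_eta S) (mx22_eta A) tr_mx22 !mul_mx22 det_mx22 /skew_coef !mx22E.
ring.
Qed.

Lemma sym_disc_congr S A : sym_disc (S^T *m A *m S) = \det S ^+ 2 * sym_disc A.
Proof.
rewrite (mx22_eta S) (mx22_eta A) tr_mx22 !mul_mx22 det_mx22 /sym_disc !mx22E.
ring.
Qed.

Lemma congruent_refl A : congruent A A.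
Proof. by exists 1%:M; rewrite ?unitmx1// trmx1 mul1mx mulmx1. Qed.

Lemma congruent_sym A B : congruent A B -> congruent B A.
Proof.
move=> [S uS <-]; exists (invmx S); rewrite ?unitmx_inv// trmx_inv !mulmxA.
by rewrite mulVmx ?unitmx_tr// mul1mx mulmxK.
Qed.

Lemma congruent_trans B A D : congruent A B -> congruent B D -> congruent A D.
Proof.
move=> [S uS <-] [T uT <-]; exists (S *m T); rewrite ?unitmx_mul ?uS//.
by rewrite trmx_mul !mulmxA.
Qed.

Lemma congruent_mx22 A a b c d x y z t : x * t - y * z != 0 ->
  (mx22 x y z t)^T *m A *m mx22 x y z t = mx22 a b c d ->
  congruent A (mx22 a b c d).
Proof.
by move=> nz e; exists (mx22 x y z t) => //; rewrite unitmxE det_mx22 unitfE.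
Qed.

Lemma skewsymmetricE A :
  skewsymmetric A = [&& A 0 0 == 0, A 1 1 == 0 & A 0 1 + A 1 0 == 0].
Proof.
have two0 : (2 : C) != 0 by rewrite pnatr_eq0.
have dbl (x : C) : (x == - x) = (x == 0).
  by rewrite -subr_eq0 opprK -mulr2n -mulr_natl mulf_eq0 (negPf two0).
rewrite /skewsymmetric {1 2}(mx22_eta A) tr_mx22 opp_mx22.
apply/eqP/and3P => [/mx22_inj[/eqP + /eqP + _ /eqP]|].
  by rewrite !dbl => -> e ->; split=> //; rewrite addrC -[A 0 1]opprK subr_eq0.
move=> [/eqP -> /eqP -> e]; rewrite oppr0; congr mx22; apply/eqP.
  by rewrite -subr_eq0 opprK addrC.
by rewrite -subr_eq0 opprK.
Qed.

Lemma skewsymmetric_congr S A : skewsymmetric A -> skewsymmetric (S^T *m A *m S).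
Proof.
by move=> /eqP e; rewrite /skewsymmetric !trmx_mul trmxK e mulNmx mulmxN mulmxA.
Qed.

Lemma skewsymmetric_skew A : skewsymmetric A ->
  A = mx22 0 (skew_coef A / 2) (- (skew_coef A / 2)) 0.
Proof.
rewrite skewsymmetricE => /and3P[/eqP a0 /eqP d0]; rewrite addr_eq0 => /eqP bc.
rewrite {1}(mx22_eta A) a0 d0 /skew_coef bc.
by congr mx22; field.
Qed.

Lemma congruent_normal_form A : ~~ skewsymmetric A ->
  congruent A (mx22 1 (skew_coef A / 2) (- (skew_coef A / 2)) (sym_disc A / 4)).
Proof.
pose h : C := (A 0 1 + A 1 0) / 2.
move=> nA; have [x [y xy]] :
    exists x y : C, A 0 0 * x ^+ 2 + 2 * h * (x * y) + A 1 1 * y ^+ 2 = 1.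
  (* If a diagonal entry is nonzero, a rescaled basis vector takes the value one. Otherwise a
     multiple of [(1, 1)] does, since the form equals [A 0 1 + A 1 0] there. *)
  have [a0|a0] := eqVneq (A 0 0) 0; last first.
    exists (sqrtC (A 0 0))^-1, 0; rewrite exprVn sqrtCK divff//; ring.
  have [d0|d0] := eqVneq (A 1 1) 0; last first.
    exists 0, (sqrtC (A 1 1))^-1; rewrite exprVn sqrtCK divff//; ring.
  have bc0 : A 0 1 + A 1 0 != 0 by move: nA; rewrite skewsymmetricE a0 d0 eqxx.
  exists (sqrtC (A 0 1 + A 1 0))^-1, (sqrtC (A 0 1 + A 1 0))^-1.
  by rewrite -expr2 exprVn sqrtCK a0 d0 /h; field.
(* The second column of the transition matrix is orthogonal to the first for
   the symmetric part of [A]. *)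
pose u := A 0 0 * x + h * y; pose v := h * x + A 1 1 * y.
have uv : x * u + y * v = 1 by rewrite -xy /u /v; ring.
(* Multiplying the constant entries by the value one of the form makes both sides quadratic in [x]
   and [y], so that the equalities become polynomial identities. *)
have xyE z : z = z * (A 0 0 * x ^+ 2 + 2 * h * (x * y) + A 1 1 * y ^+ 2).
  by rewrite xy mulr1.
apply: (@congruent_mx22 _ _ _ _ _ x (- v) y u).
  by rewrite mulNr opprK [v * y]mulrC uv oner_neq0.
rewrite {1}(mx22_eta A) tr_mx22 !mul_mx22; congr mx22.
- by rewrite -xy /h; field.
- by rewrite [RHS]xyE /skew_coef /u /v /h; field.
- by rewrite [RHS]xyE /skew_coef /u /v /h; field.
- by rewrite [RHS]xyE /sym_disc /u /v /h; field.
Qed.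

(** The factor [s] is the determinant of the transition matrix. Conversely, [diag(1, s)] carries the
    normal form of [A] to that of [B], in the skew-symmetric case as well as in the other one. *)
Lemma congruentP A B : congruent A B <-> skewsymmetric A = skewsymmetric B /\
  exists s, [/\ s != 0, skew_coef B = s * skew_coef A &
                sym_disc B = s ^+ 2 * sym_disc A].
Proof.
split=> [cAB|[altE [s [s0 kE pE]]]].
  split.
    apply/idP/idP => [altA|altB].
      by case: cAB => S _ <-; apply: skewsymmetric_congr.
    by case/congruent_sym: cAB => S _ <-; apply: skewsymmetric_congr.
  case: cAB => S uS <-; exists (\det S).
  by rewrite skew_coef_congr sym_disc_congr; split; rewrite // -unitfE -unitmxE.
have [altA|altA] := boolP (skewsymmetric A).
  have altB : skewsymmetric B by rewrite -altE.
  rewrite (skewsymmetric_skew altA) (skewsymmetric_skew altB) kE.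
  apply: (@congruent_mx22 _ _ _ _ _ 1 0 0 s); first by rewrite mul1r mul0r subr0.
  by rewrite tr_mx22 !mul_mx22; congr mx22; field.
apply: congruent_trans (congruent_normal_form altA) _.
apply/congruent_sym/(congruent_trans (congruent_normal_form _)); rewrite -?altE//.
apply/congruent_sym; rewrite kE pE.
apply: (@congruent_mx22 _ _ _ _ _ 1 0 0 s); first by rewrite mul1r mul0r subr0.
by rewrite tr_mx22 !mul_mx22; congr mx22; field.
Qed.

(** * Congruence classes and their closures *)

Lemma congr_class_eqP A B : congr_class A = congr_class B <-> congruent A B.
Proof.
split=> [e|cAB]; first by have : congr_class B B := congruent_refl B; rewrite -e.
apply/seteqP; split=> X /= cX; last exact: congruent_trans cAB cX.
exact: congruent_trans (congruent_sym cAB) cX.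
Qed.

(* Continuity of [f] at [A] is tested along an abstract filter [G]: instance
   resolution fails on [nbhs A] for a matrix [A]. *)
Lemma closure_congr_zero (f : 'M[C]_2 -> C) A B :
  (forall (G : set_system 'M[C]_2) (D : 'M[C]_2), Filter G ->
     (forall i j, (fun X => X i j) @ G --> D i j) -> f @ G --> f D) ->
  (forall X, congruent B X -> f X = 0) -> closure (congr_class B) A -> f A = 0.
Proof.
move=> cf f0 clA.
have {}cf : continuous f.
  move=> D; apply: (cf _ _ (nbhs_filter D)) => i j; exact: coord_continuous.
suff /(_ A) : closed (f @^-1` [set 0]) by apply; apply: closureS clA.
move/continuous_closedP: cf; apply.
exact/accessible_closed_set1/hausdorff_accessible/norm_hausdorff.
Qed.

Lemma cvg_skew_coef (G : set_system 'M[C]_2) A : Filter G ->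
  (forall i j, (fun X => X i j) @ G --> A i j) -> skew_coef @ G --> skew_coef A.
Proof. by move=> FG cA; apply: cvgB. Qed.

Lemma cvg_sym_disc (G : set_system 'M[C]_2) A : Filter G ->
  (forall i j, (fun X => X i j) @ G --> A i j) -> sym_disc @ G --> sym_disc A.
Proof.
move=> FG cA; apply: cvgB; first by apply: cvgM; [exact: cvg_cst|exact: cvgM].
by apply: cvgM; apply: cvgD.
Qed.

(** The points [A + t *: M] with [t != 0] lie in the class of [B] and tend to [A] as [t] tends to
    zero. Transporting the line by [S] does the same for any other member of the class of [A]. *)
Lemma line_sub_closure A B M : (forall t, t != 0 -> congruent B (A + t *: M)) ->
  congr_class A `<=` closure (congr_class B).
Proof.
move=> cB X [S uS <-] U nU.
have /(_ U nU) : (fun t : C => S^T *m A *m S + t *: (S^T *m M *m S)) @ 0^' -->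
    S^T *m A *m S.
  apply: cvg_trans (_ : _ @ 0^' --> S^T *m A *m S + 0 *: (S^T *m M *m S)) _.
    apply: cvgD; first exact: cvg_cst.
    apply: cvgZr_tmp; exact: nbhs_dnbhs.
  by rewrite scale0r addr0.
move=> nU'; have /filter_ex [t [/= t0 Ut]] : \forall t \near (0 : C)^',
    t != 0 /\ U (S^T *m A *m S + t *: (S^T *m M *m S)).
  by near=> t; split; near: t; [exact: nbhs_dnbhs_neq|].
exists (S^T *m A *m S + t *: (S^T *m M *m S)); split => //=.
apply: congruent_trans (cB t t0) _; exists S => //.
by rewrite mulmxDr mulmxDl -scalemxAr -scalemxAl.
Unshelve. all: by end_near.
Qed.

(** * The criterion for degenerations and the height *)

Lemma skew_coef_mx22 a b c d : skew_coef (mx22 a b c d) = b - c.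
Proof. by rewrite /skew_coef !mx22E. Qed.

Lemma sym_disc_mx22 a b c d : sym_disc (mx22 a b c d) = 4 * (a * d) - (b + c) ^+ 2.
Proof. by rewrite /sym_disc !mx22E. Qed.

Lemma skewsymmetric_mx22 a b c d :
  skewsymmetric (mx22 a b c d) = [&& a == 0, d == 0 & b + c == 0].
Proof. by rewrite skewsymmetricE !mx22E. Qed.

Lemma skew_coefZ t A : skew_coef (t *: A) = t * skew_coef A.
Proof. by rewrite /skew_coef !mxE mulrBr. Qed.

Lemma sym_discZ t A : sym_disc (t *: A) = t ^+ 2 * sym_disc A.
Proof. by rewrite /sym_disc !mxE; ring. Qed.

Lemma skewsymmetricZ t A : t != 0 -> skewsymmetric (t *: A) = skewsymmetric A.
Proof.
by move=> t0; rewrite !skewsymmetricE !mxE -mulrDr !mulf_eq0 (negPf t0).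
Qed.

Lemma skewsymmetric_sym_disc A : skewsymmetric A -> sym_disc A = 0.
Proof. by move/skewsymmetric_skew->; rewrite sym_disc_mx22; ring. Qed.

(** For fixed [B] these are closed conditions on [A]. The ratio of [sym_disc] to the square of
    [skew_coef] is constant on a class where it is defined; the last equation compares these ratios
    after cross-multiplication, so it survives in limits where [skew_coef] vanishes. *)
Definition degenerates A B : Prop :=
  [/\ skewsymmetric B -> skewsymmetric A,
      skew_coef B = 0 -> skew_coef A = 0,
      sym_disc B = 0 -> sym_disc A = 0 &
      sym_disc A * skew_coef B ^+ 2 = sym_disc B * skew_coef A ^+ 2].

(** This is the rank in the order and not the dimension of the class: [H2 (-1)] and [D2] both have
    height one, while their classes have dimensions one and two. Zero has height zero and all other
    classes have height two. *)
Definition height A : nat :=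
  if skewsymmetric A then nat_of_bool (skew_coef A != 0)
  else (~~ ((skew_coef A == 0) && (sym_disc A == 0))).+1.

Lemma height_congr A B : congruent A B -> height A = height B.
Proof.
move=> /congruentP[altE [s [s0 kE pE]]].
by rewrite /height altE kE pE !mulf_eq0 (negPf s0).
Qed.

Lemma degenerates_height A B : degenerates A B -> (height A <= height B)%N.
Proof.
move=> [altBA kBA pBA _]; rewrite /height.
have [altB|altB] := boolP (skewsymmetric B).
  rewrite altBA//; have [/kBA ->|] := eqVneq (skew_coef B) 0; first by rewrite eqxx.
  by rewrite leq_b1.
case: ifP => _; first by rewrite (leq_trans (leq_b1 _)).
have [/kBA ->|_] := eqVneq (skew_coef B) 0; last by rewrite ltnS leq_b1.
have [/pBA ->|_] := eqVneq (sym_disc B) 0; first by rewrite !eqxx.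
by rewrite ltnS leq_b1.
Qed.

(** If [skew_coef A] is nonzero, the factor required by [congruentP] is [skew_coef B / skew_coef A],
    and the cross-multiplied equation settles [sym_disc]. If [skew_coef A] vanishes but [sym_disc A]
    does not, that equation forces [skew_coef B = 0], and the factor is a square root of the ratio
    of discriminants. In the remaining cases the bound on the height makes the invariants of [B]
    vanish too. *)
Lemma degenerates_congruent A B : degenerates A B ->
  (height B <= height A)%N -> congruent A B.
Proof.
move=> [altBA kBA pBA kpE]; rewrite /height => htBA; apply/congruentP.
have [kA0|kA0] := eqVneq (skew_coef A) 0; last first.
  have kB0 : skew_coef B != 0 by apply: contra_neq kA0.
  have altE : skewsymmetric A = skewsymmetric B.
    apply/idP/idP => // altA; move: htBA.
    by rewrite altA kA0 (negPf kB0); case: ifP.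
  split=> //; exists (skew_coef B / skew_coef A).
  rewrite mulf_neq0 ?invr_neq0// divfK//; split=> //.
  apply: (mulIf (expf_neq0 2 kA0)); rewrite -kpE; field.
  by rewrite kA0.
have [altA|altA] := boolP (skewsymmetric A).
  move: htBA; rewrite altA kA0 eqxx; case: ifP => // altB.
  case: eqVneq => // kB0 _; split=> //; exists 1.
  by rewrite oner_neq0 kB0 !skewsymmetric_sym_disc// !mulr0.
have altB : ~~ skewsymmetric B by apply: contra altA.
split; first by rewrite (negPf altB).
move: htBA; rewrite (negPf altA) (negPf altB) kA0 eqxx /=.
have [pA0|pA0] := eqVneq (sym_disc A) 0.
  have [->|//] := eqVneq (skew_coef B) 0; have [->|//] := eqVneq (sym_disc B) 0.
  by move=> _; exists 1; rewrite oner_neq0 pA0 !mulr0.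
have pB0 : sym_disc B != 0 by apply: contra_neq pA0.
move: kpE; rewrite kA0 expr0n mulr0 => /eqP.
rewrite mulf_eq0 (negPf pA0) expf_eq0 /= => /eqP -> _.
exists (sqrtC (sym_disc B / sym_disc A)); rewrite sqrtC_eq0 sqrtCK mulr0 divfK//.
by rewrite mulf_neq0 ?invr_neq0.
Qed.

Lemma closure_congrP A B :
  congr_class A `<=` closure (congr_class B) <-> degenerates A B.
Proof.
split=> [/(_ A (congruent_refl A)) clA|degAB].
  have zero f cf f0 := @closure_congr_zero f A B cf f0 clA.
  split=> [altB|kB0|pB0|].
  - have altX X : congruent B X -> skewsymmetric X by case/congruentP => <-.
    rewrite skewsymmetricE; apply/and3P; split; apply/eqP.
    + apply: (zero (fun X => X 0 0)); first by move=> G D _; apply.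
      by move=> X /altX; rewrite skewsymmetricE => /and3P[/eqP].
    + apply: (zero (fun X => X 1 1)); first by move=> G D _; apply.
      by move=> X /altX; rewrite skewsymmetricE => /and3P[_ /eqP].
    + apply: (zero (fun X => X 0 1 + X 1 0)).
        by move=> G D FG cD; apply: cvgD.
      by move=> X /altX; rewrite skewsymmetricE => /and3P[_ _ /eqP].
  - apply: zero; first exact: cvg_skew_coef.
    by move=> X /congruentP[_ [s [_ -> _]]]; rewrite kB0 mulr0.
  - apply: zero; first exact: cvg_sym_disc.
    by move=> X /congruentP[_ [s [_ _ ->]]]; rewrite pB0 mulr0.
  - apply/eqP; rewrite -subr_eq0; apply/eqP.
    apply: (zero (fun X => sym_disc X * skew_coef B ^+ 2 -
                           sym_disc B * (skew_coef X * skew_coef X))).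
      move=> G D FG cD; have ck := cvg_skew_coef FG cD; apply: cvgB.
        by apply: cvgM; [exact: cvg_sym_disc|exact: cvg_cst].
      by apply: cvgM; [exact: cvg_cst|exact: cvgM].
    by move=> X /congruentP[_ [s [_ -> ->]]]; ring.
have [htBA|htAB] := leqP (height B) (height A).
  have /congr_class_eqP -> := degenerates_congruent degAB htBA.
  exact: subset_closure.
case: degAB => [altBA kBA pBA kpE].
have [altA|altA] := boolP (skewsymmetric A).
  have [kA0|kA0] := eqVneq (skew_coef A) 0.
    rewrite (skewsymmetric_skew altA) kA0 mul0r oppr0 -mx22_0.
    (* Scaling by [t] multiplies [skew_coef] by [t] and [sym_disc] by [t ^+ 2], so [t *: B] is
       congruent to [B]. *)
    apply: (line_sub_closure (M := B)) => t t0; apply/congruentP; rewrite add0r.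
    rewrite skewsymmetricZ//; split=> //; exists t.
    by rewrite skew_coefZ sym_discZ.
  have kB0 : skew_coef B != 0 by apply: contra_neq kA0.
  have altB : ~~ skewsymmetric B.
    by apply: contraTN htAB => altB; rewrite /height altA altB kA0 kB0.
  have pB0 : sym_disc B = 0.
    apply: (mulIf (expf_neq0 2 kA0)).
    by rewrite -kpE skewsymmetric_sym_disc// !mul0r.
  (* A corner entry [t] destroys skew-symmetry but leaves [skew_coef] unchanged and [sym_disc] equal
     to zero, as it is for [B]. *)
  apply: (line_sub_closure (M := mx22 0 0 0 1)) => t t0; apply/congruentP.
  rewrite {1 2 3}(skewsymmetric_skew altA) scale_mx22 add_mx22.
  rewrite skewsymmetric_mx22 skew_coef_mx22 sym_disc_mx22 (negPf altB).
  rewrite !mulr0 mulr1 !add0r (negPf t0) andbF; split=> //.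
  exists (skew_coef A / skew_coef B); rewrite mulf_neq0 ?invr_neq0// divfK//.
  by split=> //; rewrite ?pB0; field.
have altB : ~~ skewsymmetric B by apply: contra altA.
have [/eqP kA0 /eqP pA0] : skew_coef A == 0 /\ sym_disc A == 0.
  apply/andP; apply: contraTT htAB => kpA.
  by rewrite /height (negPf altA) (negPf altB) kpA -leqNgt ltnS leq_b1.
have -> : congr_class A = congr_class D2.
  apply/congr_class_eqP/congruentP; rewrite skewsymmetric_mx22 skew_coef_mx22.
  rewrite sym_disc_mx22 oner_eq0 (negPf altA); split=> //; exists 1.
  by rewrite oner_neq0 kA0 pA0; split=> //; ring.
(* The off-diagonal entries of the direction [M] have sum [r] and difference [skew_coef B]. Hence
   [D2 + t *: M] has invariants [t * skew_coef B] and [- (t * r) ^+ 2 = t ^+ 2 * sym_disc B]. *)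
pose r := sqrtC (- sym_disc B).
have rr : r ^+ 2 = - sym_disc B by rewrite sqrtCK.
apply: (line_sub_closure
  (M := mx22 0 ((r + skew_coef B) / 2) ((r - skew_coef B) / 2) 0)) => t t0.
apply/congruentP; rewrite scale_mx22 add_mx22.
rewrite skewsymmetric_mx22 skew_coef_mx22 sym_disc_mx22 (negPf altB).
rewrite mulr0 addr0 oner_eq0; split=> //; exists t; rewrite t0; split=> //.
  by field.
by rewrite -[sym_disc B]opprK -rr; field.
Qed.

(** * Vertices and arrows of the closure graph *)

Lemma vertex_of_eqP A B : vertex_of A = vertex_of B <-> congruent A B.
Proof.
split=> [/(congr1 sval) /congr_class_eqP //|/congr_class_eqP e].
exact: eq_exist.
Qed.

Lemma vertex_ofP V : exists A, V = vertex_of A.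
Proof. by case: V => V' rV; have [A _ e] := rV; exists A; apply: eq_exist. Qed.

Lemma closure_leP A B : closure_le (vertex_of A) (vertex_of B) <-> degenerates A B.
Proof. exact: closure_congrP. Qed.

Lemma invariants_0 : ((skewsymmetric (0 : 'M[C]_2) = true) *
  ((skew_coef (0 : 'M[C]_2) == 0) = true)) * ((sym_disc (0 : 'M[C]_2) == 0) = true).
Proof.
rewrite mx22_0 skewsymmetric_mx22 skew_coef_mx22 sym_disc_mx22.
by rewrite !addr0 subrr !mulr0 expr0n subrr !eqxx.
Qed.

Lemma invariants_HN1 : ((skewsymmetric (@H2 R (-1)) = true) *
  ((skew_coef (@H2 R (-1)) == 0) = false)) * ((sym_disc (@H2 R (-1)) == 0) = true).
Proof.
rewrite skewsymmetric_mx22 skew_coef_mx22 sym_disc_mx22.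
by rewrite subrr !mulr0 expr0n subrr opprK !eqxx -mulr2n pnatr_eq0.
Qed.

Lemma invariants_D : ((skewsymmetric (@D2 R) = false) *
  ((skew_coef (@D2 R) == 0) = true)) * ((sym_disc (@D2 R) == 0) = true).
Proof.
rewrite skewsymmetric_mx22 skew_coef_mx22 sym_disc_mx22.
by rewrite addr0 subrr !mulr0 expr0n subrr !eqxx oner_eq0.
Qed.

Lemma invariants_I : ((skewsymmetric (1%:M : 'M[C]_2) = false) *
  ((skew_coef (1%:M : 'M[C]_2) == 0) = true)) *
  ((sym_disc (1%:M : 'M[C]_2) == 0) = false).
Proof.
rewrite mx22_1 skewsymmetric_mx22 skew_coef_mx22 sym_disc_mx22.
by rewrite addr0 subrr !mulr1 expr0n subr0 !eqxx oner_eq0 pnatr_eq0.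
Qed.

Lemma invariants_Gamma : ((skewsymmetric (@Gamma2 R) = false) *
  ((skew_coef (@Gamma2 R) == 0) = false)) * ((sym_disc (@Gamma2 R) == 0) = true).
Proof.
rewrite skewsymmetric_mx22 skew_coef_mx22 sym_disc_mx22.
rewrite addNr expr0n mul0r mulr0 subrr -opprD oppr_eq0 !eqxx oner_eq0.
by rewrite -mulr2n pnatr_eq0.
Qed.

Lemma invariants_H l : l != -1 -> l != 1 -> ((skewsymmetric (H2 l) = false) *
  ((skew_coef (H2 l) == 0) = false)) * ((sym_disc (H2 l) == 0) = false).
Proof.
move=> lN1 l1; rewrite skewsymmetric_mx22 skew_coef_mx22 sym_disc_mx22.
rewrite !mulr0 sub0r oppr_eq0 expf_eq0 /= eqxx addrC addr_eq0 (negPf lN1).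
by rewrite subr_eq0 eq_sym (negPf l1).
Qed.

(** A jump of two in height starts at zero and ends at a matrix that is not skew-symmetric, and the
    class of [D2] lies strictly between them. Conversely, when the heights differ by one, an
    intermediate vertex has the height of one of the ends and therefore coincides with it. *)
Lemma closure_arrowP A B : closure_arrow (vertex_of A) (vertex_of B) <->
  degenerates A B /\ height B = (height A).+1.
Proof.
split=> [[neq /closure_leP degAB cover]|[degAB htE]].
  split=> //; have [htBA|htAB] := leqP (height B) (height A).
    by case: neq; apply/vertex_of_eqP; exact: degenerates_congruent.
  apply/eqP; rewrite eqn_leq htAB andbT leqNgt; apply/negP => htAB2.
  have htB2 : (height B <= 2)%N.
    rewrite /height; case: ifP => _; last by rewrite ltnS leq_b1.
    exact: leq_trans (leq_b1 _) _.
  have htA0 : height A = 0%N.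
    by move: htAB2 (leq_trans htAB2 htB2); case: (height A).
  have htB : height B = 2 by apply/anti_leq; rewrite htB2 (leq_trans _ htAB2).
  have htD : height (@D2 R) = 1%N. by rewrite /height !invariants_D.
  have [altA kA0] : skewsymmetric A /\ skew_coef A = 0.
    move: htA0; rewrite /height; case: ifP => // _.
    by case: eqP.
  have altB : ~~ skewsymmetric B.
    by apply: contra_eqN htB => altB; rewrite /height altB; case: (skew_coef B == 0).
  have := cover (vertex_of D2); case.
  - apply/closure_leP; split=> // [_|].
      exact: skewsymmetric_sym_disc.
    by rewrite skewsymmetric_sym_disc// kA0 expr0n mul0r mulr0.
  - apply/closure_leP; split; first by rewrite (negPf altB).
    + by move=> _; apply/eqP; rewrite invariants_D.
    + by move=> _; apply/eqP; rewrite invariants_D.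
    + have [/eqP -> /eqP ->] : sym_disc (@D2 R) == 0 /\ skew_coef (@D2 R) == 0.
        by rewrite !invariants_D.
      by rewrite expr0n mul0r mulr0.
  - by move/vertex_of_eqP/height_congr; rewrite htD htA0.
  - by move/vertex_of_eqP/height_congr; rewrite htD htB.
split; last 1 first.
- move=> U; have [D ->] := vertex_ofP U => /closure_leP degAD /closure_leP degDB.
  have := degenerates_height degAD; rewrite leq_eqVlt => /orP[/eqP htD|htD].
    by left; apply/esym/vertex_of_eqP/degenerates_congruent; rewrite // htD.
  by right; apply/vertex_of_eqP/degenerates_congruent; rewrite // htE.
- by move/vertex_of_eqP/height_congr => e; move: htE; rewrite e => /n_Sn.
- exact/closure_leP.
Qed.

(** * Canonical matrices: existence and uniqueness *)

Variant canonical_spec : 'M[C]_2 -> bool -> bool -> bool -> Prop :=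
| Canonical0 : canonical_spec 0 true true true
| CanonicalHN1 : canonical_spec (H2 (-1)) true false true
| CanonicalD : canonical_spec D2 false true true
| CanonicalI : canonical_spec 1%:M false true false
| CanonicalGamma : canonical_spec Gamma2 false false true
| CanonicalH l of l != -1 & l != 1 : canonical_spec (H2 l) false false false.

(** Case analysis through this lemma evaluates the three tests in a goal together with [F]. The six
    triples of Booleans are distinct, so congruent canonical matrices belong to the same
    constructor. *)
Lemma canonicalP F : canonical2 F -> canonical_spec F (skewsymmetric F)
  (skew_coef F == 0) (sym_disc F == 0).
Proof.
case=> [[[->|->|->|->]|->]|[l [lN1 l1] <-]].
- rewrite !invariants_0; exact: Canonical0.
- rewrite !invariants_D; exact: CanonicalD.
- rewrite !invariants_I; exact: CanonicalI.
- rewrite !invariants_HN1; exact: CanonicalHN1.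
- rewrite !invariants_Gamma; exact: CanonicalGamma.
- rewrite !(invariants_H lN1 l1); exact: CanonicalH.
Qed.

Lemma canonical_0 : canonical2 (0 : 'M[C]_2). Proof. by left; left; constructor. Qed.
Lemma canonical_D : canonical2 (@D2 R). Proof. by left; left; constructor. Qed.
Lemma canonical_I : canonical2 (1%:M : 'M[C]_2). Proof. by left; left; constructor. Qed.
Lemma canonical_HN1 : canonical2 (@H2 R (-1)). Proof. by left; left; constructor. Qed.
Lemma canonical_Gamma : canonical2 (@Gamma2 R). Proof. by left; right. Qed.
Lemma canonical_H l : l != -1 -> l != 1 -> canonical2 (H2 l).
Proof. by right; exists l. Qed.

(** The factor for [congruentP] compares an invariant of [A] with its value at the canonical matrix:
    [skew_coef] is [2] at [H2 (-1)] and [- 2] at [Gamma2], and [sym_disc] is [4] at the identity,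
    which calls for a square root. *)
Lemma exists_canonical A : exists2 F, canonical2 F & congruent A F.
Proof.
have two0 : (2 : C) != 0 by rewrite pnatr_eq0.
have [altA|altA] := boolP (skewsymmetric A).
  have pA0 := skewsymmetric_sym_disc altA.
  have [kA0|kA0] := eqVneq (skew_coef A) 0.
    exists 0; first exact: canonical_0.
    rewrite (skewsymmetric_skew altA) kA0 mul0r oppr0 -mx22_0.
    exact: congruent_refl.
  exists (H2 (-1)); first exact: canonical_HN1.
  apply/congruentP; rewrite skewsymmetric_mx22 skew_coef_mx22 sym_disc_mx22.
  rewrite altA subrr !eqxx; split=> //; exists (2 / skew_coef A).
  rewrite mulf_neq0 ?invr_neq0// divfK// pA0; split=> //; ring.
have [kA0|kA0] := eqVneq (skew_coef A) 0.
  have [pA0|pA0] := eqVneq (sym_disc A) 0.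
    exists D2; first exact: canonical_D.
    apply/congruentP; rewrite skewsymmetric_mx22 skew_coef_mx22 sym_disc_mx22.
    rewrite (negPf altA) oner_eq0; split=> //; exists 1.
    by rewrite oner_neq0 kA0 pA0; split=> //; ring.
  exists 1%:M; first exact: canonical_I.
  apply/congruentP; rewrite mx22_1 skewsymmetric_mx22 skew_coef_mx22 sym_disc_mx22.
  rewrite (negPf altA) oner_eq0; split=> //; exists (2 / sqrtC (sym_disc A)).
  rewrite mulf_neq0 ?invr_neq0 ?sqrtC_eq0// kA0 mulr0 subrr; split=> //.
  by rewrite expr_div_n sqrtCK divfK//; ring.
have [pA0|pA0] := eqVneq (sym_disc A) 0.
  exists Gamma2; first exact: canonical_Gamma.
  apply/congruentP; rewrite skewsymmetric_mx22 skew_coef_mx22 sym_disc_mx22.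
  rewrite (negPf altA) oner_eq0 andbF; split=> //; exists (- 2 / skew_coef A).
  rewrite mulf_neq0 ?invr_neq0 ?oppr_eq0// divfK// pA0; split=> //; ring.
(* The conditions are [1 - l = s k] and [1 + l = s r] with [r ^+ 2 = - p]. *)
have [r rr rk] : exists2 r, r ^+ 2 = - sym_disc A & r + skew_coef A != 0.
  pose r := sqrtC (- sym_disc A); have rr : r ^+ 2 = - sym_disc A by rewrite sqrtCK.
  (* The sum of the two conditions is [2 = s (r + k)]. If [r + k] vanishes, the opposite root gives
     [2 k] instead, which is nonzero. *)
  have [rk|rk] := eqVneq (r + skew_coef A) 0; last by exists r.
  exists (- r); first by rewrite sqrrN.
  have -> : - r = skew_coef A by apply/eqP; rewrite eqr_oppLR -addr_eq0 rk.
  by rewrite -mulr2n -mulr_natl mulf_neq0.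
have r0 : r != 0.
  by apply: contra_neq pA0 => r0; rewrite -[LHS]opprK -rr r0 expr0n oppr0.
pose s := 2 / (r + skew_coef A); have s0 : s != 0 by rewrite mulf_neq0 ?invr_neq0.
pose l := s * r - 1.
have lk : 1 - l = s * skew_coef A by rewrite /l /s; field.
have lN1 : l != -1 by rewrite -subr_eq0 opprK /l subrK mulf_neq0.
have l1 : l != 1 by rewrite eq_sym -subr_eq0 lk mulf_neq0.
exists (H2 l); first exact: canonical_H.
apply/congruentP; rewrite skewsymmetric_mx22 skew_coef_mx22 sym_disc_mx22.
rewrite (negPf altA) eqxx addrC addr_eq0 (negPf lN1); split=> //; exists s; split=> //.
by rewrite -[sym_disc A]opprK -rr /l; ring.
Qed.

(** Here [k = 1 - l] and [p = - (1 + l) ^+ 2], so a congruence yields [1 - l' = s (1 - l)] and, up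
    to sign, [1 + l' = s (1 + l)]. Adding and subtracting gives [s = 1] and [l' = l] for the plus
    sign, [l s = -1] and [l' = - s] for the minus sign. *)
Lemma congruent_H2P l l' :
  congruent (H2 l) (H2 l') <-> H2 l = H2 l' \/ (l != 0 /\ l' = l^-1).
Proof.
split=> [/congruentP|[->|[l0 ->]]]; last 2 first.
- exact: congruent_refl.
- apply/congruentP; rewrite !skewsymmetric_mx22 !skew_coef_mx22 !sym_disc_mx22.
  rewrite !eqxx /=; split; last first.
    by exists (- l^-1); rewrite oppr_eq0 invr_eq0; split=> //; field.
  rewrite ![1 + _]addrC !addr_eq0 -[RHS](inj_eq (@invr_inj C)).
  by rewrite invrK invrN invr1.
rewrite !skew_coef_mx22 !sym_disc_mx22 => -[_ [s [s0 kE pE]]].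
have /eqP : (1 + l') ^+ 2 = (s * (1 + l)) ^+ 2.
  by apply: oppr_inj; move: pE; rewrite !mulr0 !sub0r exprMn mulrN.
have two0 : (2 : C) != 0 by rewrite pnatr_eq0.
rewrite eqf_sqr => /orP[/eqP sE|/eqP sE].
  left; have s1 : s = 1.
    by apply: (mulIf two0); transitivity ((1 - l') + (1 + l')); [rewrite kE sE|]; ring.
  by move: sE; rewrite s1 mul1r => /addrI ->.
have ls : l * s = -1.
  apply: (mulIf two0); transitivity (- ((1 - l') + (1 + l'))); [rewrite kE sE|]; ring.
have l's : l' = - s.
  apply: (mulIf two0); transitivity ((1 + l') - (1 - l')); [|rewrite kE sE]; ring.
have l0 : l != 0.
  by apply: contra_eq_neq ls => ->; rewrite mul0r eq_sym oppr_eq0 oner_neq0.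
right; split=> //; apply: (mulfI l0); rewrite l's mulrN ls opprK divff//.
Qed.

Lemma canonical_unique F F' : canonical2 F -> canonical2 F' ->
  congruent F F' <-> F = F' \/ exists l, [/\ l != 0, F = H2 l & F' = H2 l^-1].
Proof.
move=> cF cF'; split; last first.
  move=> [->|[l [l0 -> ->]]]; first exact: congruent_refl.
  by apply/congruent_H2P; right.
move=> cFF'; have [altE [s [s0 kE pE]]] := (congruentP _ _).1 cFF'.
have kz : (skew_coef F' == 0) = (skew_coef F == 0).
  by rewrite kE mulf_eq0 (negPf s0).
have pz : (sym_disc F' == 0) = (sym_disc F == 0).
  by rewrite pE mulf_eq0 expf_eq0 (negPf s0).
move: altE kz pz cFF'; case: (canonicalP cF) => [|||||l _ _];
  case: (canonicalP cF') => [|||||l' _ _] //=; try by left.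
move=> _ _ _ /congruent_H2P[|[l0 ->]]; first by left.
by right; exists l.
Qed.

(** * Dimensions of the congruence classes *)

(** The tangent vector of [S^T A S] given by [X] is the image under [phi], that is [Y] to [S^T Y S],
    of the tangent vector of [A] given by [S X S^-1]. This bounds one dimension by the other, and
    symmetry of congruence gives equality. *)
Lemma congr_class_dim_congr A B : congruent A B ->
  congr_class_dim A = congr_class_dim B.
Proof.
suff le A' B' : congruent A' B' -> (congr_class_dim B' <= congr_class_dim A')%N.
  by move=> cAB; apply: anti_leq; rewrite !le//; apply: congruent_sym.
move=> {A B} [S uS <-].
pose phi : 'End('M[C]_2) := linfun (mulmxr S \o mulmx S^T).
apply: (@leq_trans (\dim (phi @: limg (linfun (congr_tangent A'))))); last first.
  by rewrite -[leqRHS](limg_ker_dim phi) leq_addl.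
apply: dimvS; apply/subvP => _ /memv_imgP[X _ ->]; rewrite lfunE /=.
have -> : congr_tangent (S^T *m A' *m S) X =
    phi (linfun (congr_tangent A') (S *m X *m invmx S)).
  rewrite !lfunE /= /congr_tangent !trmx_mul trmx_inv mulmxDr mulmxDl !mulmxA.
  by rewrite mulmxV ?unitmx_tr// mul1mx mulmxKV.
by apply/memv_img/memv_img/memvf.
Qed.

Lemma congr_tangent_mx22 a b c d x y z w :
  congr_tangent (mx22 a b c d) (mx22 x y z w) =
  mx22 (2 * a * x + (b + c) * z) (b * (x + w) + a * y + d * z)
       (c * (x + w) + a * y + d * z) ((b + c) * y + 2 * d * w).
Proof.
by rewrite /congr_tangent tr_mx22 !mul_mx22 add_mx22; congr mx22; ring.
Qed.

(** For skew-symmetric [A] the tangent map sends [X] to the trace of [X] times [A]. Otherwise [A]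
    may be replaced by its normal form, whose tangent space is spanned by [e1], [e2] and [e3]; here
    [e3] vanishes exactly when [k] and [p] do. *)
Lemma congr_class_dimE A : congr_class_dim A =
  if skewsymmetric A then nat_of_bool (skew_coef A != 0)
  else if (skew_coef A == 0) && (sym_disc A == 0) then 2 else 3.
Proof.
have two0 : (2 : C) != 0 by rewrite pnatr_eq0.
have [altA|altA] := boolP (skewsymmetric A).
  rewrite {1}(skewsymmetric_skew altA); set k := skew_coef A / 2.
  have <- : (k == 0) = (skew_coef A == 0).
    by rewrite mulf_eq0 invr_eq0 (negPf two0) orbF.
  pose e : seq 'M[C]_2 := if k == 0 then [::] else [:: mx22 0 k (- k) 0].
  transitivity (size e); last by rewrite /e; case: eqP.
  apply: dim_limg_span; rewrite /e.
  - case: eqVneq => [_|k0]; first exact: nil_free.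
    rewrite seq1_free mx22_0; apply: contra_neq k0 => /mx22_inj[_ ->] //.
  - move=> X; rewrite lfunE /= (mx22_eta X) congr_tangent_mx22.
    have [->|k0] := eqVneq k 0.
      by rewrite span_nil memv0 mx22_0; apply/eqP; congr mx22; ring.
    rewrite span_seq1; apply/vlineP; exists (X 0 0 + X 1 1).
    by rewrite scale_mx22; congr mx22; ring.
  - move=> v; case: eqVneq => // k0; rewrite inE => /eqP ->.
    exists (mx22 1 0 0 0); rewrite lfunE /= congr_tangent_mx22; congr mx22; ring.
rewrite (congr_class_dim_congr (congruent_normal_form altA)).
set k := skew_coef A / 2; set p := sym_disc A / 4.
have four0 : (4 : C) != 0 by rewrite pnatr_eq0.
have <- : (k == 0) = (skew_coef A == 0).
  by rewrite mulf_eq0 invr_eq0 (negPf two0) orbF.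
have <- : (p == 0) = (sym_disc A == 0).
  by rewrite mulf_eq0 invr_eq0 (negPf four0) orbF.
clearbody k p => {A altA}.
(* These are the images of the matrix units at [(0, 0)], [(0, 1)] and [(1, 1)]; the remaining unit
   is sent to [p *: e2]. *)
pose e1 := mx22 2 k (- k) 0; pose e2 : 'M[C]_2 := mx22 0 1 1 0.
pose e3 := mx22 0 k (- k) (2 * p).
have TE X : congr_tangent (mx22 1 k (- k) p) X =
    X 0 0 *: e1 + (X 0 1 + p * X 1 0) *: e2 + X 1 1 *: e3.
  rewrite (mx22_eta X) congr_tangent_mx22 !scale_mx22 !add_mx22 !mx22E.
  by congr mx22; ring.
(* This serves both freeness proofs: the pair [e1], [e2] is treated as the triple with last
   coefficient zero. *)
have comb0 x y w : x *: e1 + y *: e2 + w *: e3 = 0 ->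
    [/\ x = 0, y = 0, w * k = 0 & w * p = 0].
  rewrite !scale_mx22 !add_mx22 mx22_0 => /mx22_inj[/eqP].
  rewrite !mulr0 !addr0 mulf_eq0 (negPf two0) orbF => /eqP ->.
  rewrite !mul0r !add0r !mulr1 => e01 e10 e11.
  have y0 : y = 0.
    by apply: (mulIf two0); rewrite mul0r -[RHS](addr0 0) -{1}e01 -e10; ring.
  split=> //; first by rewrite -e01 y0 add0r.
  by apply: (mulIf two0); rewrite mul0r -e11; ring.
have im1 : linfun (congr_tangent (mx22 1 k (- k) p)) (mx22 1 0 0 0) = e1.
  by rewrite lfunE /= TE !mx22E mulr0 addr0 scale1r !scale0r !addr0.
have im2 : linfun (congr_tangent (mx22 1 k (- k) p)) (mx22 0 1 0 0) = e2.
  by rewrite lfunE /= TE !mx22E mulr0 addr0 scale1r !scale0r addr0 add0r.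
have im3 : linfun (congr_tangent (mx22 1 k (- k) p)) (mx22 0 0 0 1) = e3.
  by rewrite lfunE /= TE !mx22E mulr0 addr0 scale1r !scale0r !add0r.
have [/andP[/eqP k0 /eqP p0]|kp] := boolP (_ && _).
  rewrite -[RHS]/(size [:: e1; e2]); apply: dim_limg_span.
  - apply/(@freeP _ _ 2 [tuple e1; e2]) => u.
    rewrite !big_ord_recr big_ord0 /= add0r.
    rewrite -[X in X = 0 -> _]addr0 -[X in _ + X = 0 -> _](scale0r e3).
    move=> /comb0[u0 u1 _ _] [[|[|[]]] // lti].
      by rewrite -u0; congr u; apply/val_inj.
    by rewrite -u1; congr u; apply/val_inj.
  - move=> X; rewrite lfunE /= TE.
    have -> : e3 = 0 by rewrite /e3 k0 p0 mulr0 oppr0 -mx22_0.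
    by rewrite scaler0 addr0 memvD// memvZ// memv_span// !inE eqxx ?orbT.
  - by move=> v; rewrite !inE => /orP[]/eqP ->;
      [exists (mx22 1 0 0 0)|exists (mx22 0 1 0 0)].
rewrite -[RHS]/(size [:: e1; e2; e3]); apply: dim_limg_span.
- apply/(@freeP _ _ 3 [tuple e1; e2; e3]) => u.
  rewrite !big_ord_recr big_ord0 /= add0r.
  move=> /comb0[u0 u1 /eqP + /eqP]; rewrite !mulf_eq0.
  have [u2 _ _|_ /= k0 p0] := eqVneq; last by rewrite k0 p0 in kp.
  move=> [[|[|[|[]]]] // lti].
  - by rewrite -u0; congr u; apply/val_inj.
  - by rewrite -u1; congr u; apply/val_inj.
  - by rewrite -u2; congr u; apply/val_inj.
- move=> X; rewrite lfunE /= TE.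
  by rewrite !memvD// memvZ// memv_span// !inE eqxx ?orbT.
- by move=> v; rewrite !inE => /or3P[]/eqP ->;
    [exists (mx22 1 0 0 0)|exists (mx22 0 1 0 0)|exists (mx22 0 0 0 1)].
Qed.

(** * The list of arrows *)

(** The heights and the knowledge of which invariants vanish decide all thirty-six pairs of
    canonical types. *)
Lemma closure_arrow_canonical F F' : canonical2 F -> canonical2 F' ->
  closure_arrow (vertex_of F) (vertex_of F') ->
  (F = 0 /\ F' = H2 (-1)) \/
  (F = 0 /\ F' = D2) \/
  (F = H2 (-1) /\ F' = Gamma2) \/
  (F = D2 /\ F' = Gamma2) \/
  (F = D2 /\ F' = 1%:M) \/
  (exists l : C, [/\ l != -1, l != 1, F = D2 & F' = H2 l]).
Proof.
move=> cF cF' /closure_arrowP[[_ kFF' _ /eqP]].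
have {}kFF' : (skew_coef F' == 0) ==> (skew_coef F == 0).
  by apply/implyP => /eqP /kFF' ->.
(* The cross-multiplied equation is reduced to a statement about vanishing: if [skew_coef F] is
   nonzero and [sym_disc F] is zero, then [sym_disc F'] is zero. This excludes an arrow from
   [H2 (-1)] to [H2 l]. *)
rewrite /height => kpE; have {kpE} : (skew_coef F == 0) || (sym_disc F != 0)
    || (sym_disc F' == 0).
  apply: contraTT kpE; rewrite !negb_or negbK => /andP[/andP[kF /eqP ->]] pF'.
  by rewrite mul0r eq_sym !mulf_neq0.
move: kFF'; case: (canonicalP cF) => [|||||l lN1 l1] /=;
  case: (canonicalP cF') => [|||||l' l'N1 l'1] //= _ _ _; try tauto.
by do 5![right]; exists l'.
Qed.

(** Every listed arrow starts at a matrix with [sym_disc] zero, where the cross-multiplied equation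
    only asks that [sym_disc F'] or [skew_coef F] vanish. The hypotheses can then be evaluated from
    the vanishing of the invariants at the canonical matrices. *)
Lemma closure_arrow_height F F' : sym_disc F == 0 ->
  height F' = (height F).+1 -> (skewsymmetric F' -> skewsymmetric F) ->
  (skew_coef F == 0) || (skew_coef F' != 0) && (sym_disc F' == 0) ->
  closure_arrow (vertex_of F) (vertex_of F').
Proof.
move=> /eqP p0 htE alt kE; apply/closure_arrowP; split=> //; split=> //.
  by case/orP: kE => [/eqP //|/andP[/eqP]].
rewrite p0 mul0r; case/orP: kE => [/eqP ->|/andP[_ /eqP ->]]; last by rewrite mul0r.
by rewrite expr0n mulr0.
Qed.

Lemma closure_arrow2P V W : closure_arrow V W <->
  (V = vertex_of 0 /\ W = vertex_of (H2 (-1))) \/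
  (V = vertex_of 0 /\ W = vertex_of D2) \/
  (V = vertex_of (H2 (-1)) /\ W = vertex_of Gamma2) \/
  (V = vertex_of D2 /\ W = vertex_of Gamma2) \/
  (V = vertex_of D2 /\ W = vertex_of 1%:M) \/
  (exists l : C, [/\ l != -1, l != 1, V = vertex_of D2 & W = vertex_of (H2 l)]).
Proof.
split.
  have canonical (U : closure_vertex R 2) :
      exists2 F, canonical2 F & U = vertex_of F.
    have [A ->] := vertex_ofP U; have [F cF AF] := exists_canonical A.
    by exists F => //; apply/vertex_of_eqP.
  have [F cF ->] := canonical V; have [F' cF' ->] := canonical W.
  case/(closure_arrow_canonical cF cF') => [[-> ->]|]; first by left.
  case=> [[-> ->]|]; first by right; left.
  case=> [[-> ->]|]; first by do 2![right]; left.
  case=> [[-> ->]|]; first by do 3![right]; left.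
  case=> [[-> ->]|]; first by do 4![right]; left.
  by case=> l [lN1 l1 -> ->]; do 5![right]; exists l.
case=> [[-> ->]|].
  by apply: closure_arrow_height; rewrite /height ?invariants_0 ?invariants_HN1.
case=> [[-> ->]|].
  by apply: closure_arrow_height; rewrite /height ?invariants_0 ?invariants_D.
case=> [[-> ->]|].
  by apply: closure_arrow_height; rewrite /height ?invariants_HN1 ?invariants_Gamma.
case=> [[-> ->]|].
  by apply: closure_arrow_height; rewrite /height ?invariants_D ?invariants_Gamma.
case=> [[-> ->]|].
  by apply: closure_arrow_height; rewrite /height ?invariants_D ?invariants_I.
case=> l [lN1 l1 -> ->].
by apply: closure_arrow_height; rewrite /height ?invariants_D ?(invariants_H lN1 l1).
Qed.

Lemma congr_class_dim_class F A : congr_class F A ->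
  congr_class_dim A = if skewsymmetric F then nat_of_bool (skew_coef F != 0)
  else if (skew_coef F == 0) && (sym_disc F == 0) then 2 else 3.
Proof. by move=> /congr_class_dim_congr <-; exact: congr_class_dimE. Qed.

End Congruence2.

Theorem theorem2p2 (R : realType) :
  [/\ (* every matrix is congruent to a canonical matrix *)
      forall A : 'M[Cplx R]_2, exists2 F, canonical2 F & congruent A F,
      (* ... which is unique up to identifying H2 l and H2 l^-1 *)
      forall F F' : 'M[Cplx R]_2, canonical2 F -> canonical2 F' ->
        (congruent F F' <->
         F = F' \/
         exists l : Cplx R, [/\ l != 0, F = H2 l & F' = H2 l^-1]),
      (* the arrows of the closure graph *)
      forall V W : closure_vertex R 2,
        closure_arrow V W <->
        (V = vertex_of 0 /\ W = vertex_of (H2 (-1))) \/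
        (V = vertex_of 0 /\ W = vertex_of D2) \/
        (V = vertex_of (H2 (-1)) /\ W = vertex_of Gamma2) \/
        (V = vertex_of D2 /\ W = vertex_of Gamma2) \/
        (V = vertex_of D2 /\ W = vertex_of 1%:M) \/
        (exists l : Cplx R,
           [/\ l != -1, l != 1, V = vertex_of D2 & W = vertex_of (H2 l)]) &
      (* the dimensions of the congruence classes, at every point of the class *)
      forall A : 'M[Cplx R]_2,
        (congr_class 0 A -> congr_class_dim A = 0%N) /\
        (congr_class (H2 (-1)) A -> congr_class_dim A = 1%N) /\
        (congr_class D2 A -> congr_class_dim A = 2%N) /\
        (congr_class Gamma2 A -> congr_class_dim A = 3%N) /\
        (congr_class 1%:M A -> congr_class_dim A = 3%N) /\
        (forall l : Cplx R, l != -1 -> l != 1 ->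
           congr_class (H2 l) A -> congr_class_dim A = 3%N)].
Proof.
split.
- exact: exists_canonical.
- exact: canonical_unique.
- exact: closure_arrow2P.
move=> A; split; first by move/congr_class_dim_class ->; rewrite !invariants_0.
split; first by move/congr_class_dim_class ->; rewrite !invariants_HN1.
split; first by move/congr_class_dim_class ->; rewrite !invariants_D.
split; first by move/congr_class_dim_class ->; rewrite !invariants_Gamma.
split; first by move/congr_class_dim_class ->; rewrite !invariants_I.
by move=> l lN1 l1 /congr_class_dim_class ->; rewrite !(invariants_H lN1 l1).
Qed.
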